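(* Let $P$ be a finite poset and $L$ its ideal lattice. The following conditions are equivalent: (a) For $I_L$ the Hibi relations are indispensable. (b) $L$ is conditionally URC. (c) In the poset $P$, all poset ideals are generated by at most $2$ elements. (d) The poset $P$ can be covered by two disjoint chains, i.e., there are chains $C$ and $D$ in $P$ such that $V(P)=V(C)\cup V(D)$ and $V(C)\cap V(D)=\emptyset$. (e) $L$ can be embedded as a full sublattice in $[m]_0\times[n]_0$, where $m=|C|$ and $n=|D|$ for some pair of chains $C$, $D$ in $P$ with $V(P)=V(C)\cup V(D)$ and $V(C)\cap V(D)=\emptyset$.
   Context: The ideal lattice of a finite poset $P$ is the (finite distributive) lattice of all poset ideals (down-closed subsets, including $\emptyset$) of $P$, ordered by inclusion; meet is intersection and join is union. $V(P)$ denotes the underlying set of $P$; chains are totally ordered subsets and may be empty. A poset ideal is generated by a set $G\subseteq P$ if it equals $\{p\in P : p\le g \text{ for some } g\in G\}$. Fix a field $K$ and let $T=K[\{z_a : a\in L\}]$ be the polynomial ring with variables indexed by the elements of $L$. The Hibi relation ideal of $L$ is $I_L=(z_az_b-z_{a\wedge b}z_{a\vee b} : a,b\in L)\subset T$. The Hibi relations are the (nonzero) binomials $z_az_b-z_{a\wedge b}z_{a\vee b}$, i.e. those with $a,b\in L$ incomparable; they are regarded up to sign. The Hibi relations are called indispensable if each of them appears (up to sign) in every minimal generating set of $I_L$ consisting of binomials (differences of two monomials). For an interval $[a,b]$ of $L$ and $c,d\in[a,b]$, the set $\{c,d\}$ is a complementary set of $[a,b]$ if $c\vee d=b$, $c\wedge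 d=a$ and $\{c,d\}\ne\{a,b\}$. $L$ is conditionally URC (conditionally uniquely relatively complemented) if for each interval $[a,b]$ of $L$, a complementary set of $[a,b]$ is unique provided it exists. For an integer $k\ge 0$, $[k]_0=\{0,1,\dots,k\}$ with the usual order, and $[m]_0\times[n]_0$ carries the componentwise order. A sublattice of $[m]_0\times[n]_0$ is full if it contains a chain of length $m+n$ (i.e. a chain with $m+n+1$ elements). *)

(* Defs.v *)
From HB Require Import structures.
From mathcomp Require Import all_boot all_order all_algebra.
From mathcomp Require Import mpoly.

Set Implicit Arguments.
Unset Strict Implicit.
Unset Printing Implicit Defensive.

Import Order.TTheory GRing.Theory.
(* orders [{set T}] by inclusion, with meet [:&:] and join [:|:] *)
Import Order.DefaultSetSubsetOrder.
Local Open Scope order_scope.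

Definition chain d (P : finPOrderType d) (C : {set P}) : Prop :=
  {in C &, forall x y, x >=< y}.

Definition disjoint_chain_cover d (P : finPOrderType d) (C D : {set P}) : Prop :=
  [/\ chain C, chain D, C :|: D = [set: P] & C :&: D = set0].

Definition poset_ideal d (P : finPOrderType d) : {pred {set P}} :=
  fun I => [forall x in I, forall y, (y <= x) ==> (y \in I)].

Lemma poset_idealP d (P : finPOrderType d) (I : {set P}) :
  reflect (forall x y, x \in I -> y <= x -> y \in I) (poset_ideal I).
Proof.
apply: (iffP forall_inP) => [h x y /h /forallP/(_ y)/implyP | h x xI].
  by apply.
by apply/forallP => y; apply/implyP; apply: h.
Qed.

Definition generates d (P : finPOrderType d) (G I : {set P}) : Prop :=
  I = [set p | [exists g in G, (p <= g)%O]].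

Record ideal_lattice d (P : finPOrderType d) := IdealLattice {
  ideal_set : {set P};
  _ : poset_ideal ideal_set
}.

Section IdealLattice.
Context {d : Order.disp_t} {P : finPOrderType d}.

HB.instance Definition _ := [isSub for @ideal_set d P].
HB.instance Definition _ := [Finite of ideal_lattice P by <:].

Fact poset_ideal_meet : meet_closed (@poset_ideal d P).
Proof.
move=> I J /poset_idealP hI /poset_idealP hJ; apply/poset_idealP => x y.
by case/setIP=> xI xJ yx; apply/setIP; split; [apply: hI yx | apply: hJ yx].
Qed.

Fact poset_ideal_join : join_closed (@poset_ideal d P).
Proof.
move=> I J /poset_idealP hI /poset_idealP hJ; apply/poset_idealP => x y.
case/setUP=> [xI | xJ] yx; apply/setUP; first by left; apply: hI yx.
by right; apply: hJ yx.
Qed.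

Fact poset_ideal_bot : (\bot : {set P}) \in @poset_ideal d P.
Proof. by apply/poset_idealP => x y; rewrite in_set0. Qed.

Fact poset_ideal_top : (\top : {set P}) \in @poset_ideal d P.
Proof. by apply/poset_idealP => x y _ _; rewrite in_setT. Qed.

HB.instance Definition _ := Order.SubChoice_isTBSubLattice.Build
  _ _ _ Order.SetSubsetOrder.subset_display (ideal_lattice P)
  poset_ideal_meet poset_ideal_join poset_ideal_bot poset_ideal_top.

Fact ideal_lattice_meetUl :
  @left_distributive (ideal_lattice P) _ Order.meet Order.join.
Proof. by move=> I J H; apply: val_inj; apply: meetUl. Qed.

HB.instance Definition _ := Order.Lattice_Meet_isDistrLattice.Build
  _ (ideal_lattice P) ideal_lattice_meetUl.

End IdealLattice.

Section ConditionallyURC.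
Context {disp : Order.disp_t} {L : finLatticeType disp}.
Implicit Types (a b c d : L) (S : {set L}).

Definition complementary_set a b S : Prop :=
  exists c d, [/\ S = [set c; d], a <= c <= b, a <= d <= b,
                  c `|` d = b /\ c `&` d = a & [set c; d] != [set a; b]].

End ConditionallyURC.

Definition conditionally_URC disp (L : finLatticeType disp) : Prop :=
  forall a b : L, a <= b ->
  forall S S' : {set L},
    complementary_set a b S -> complementary_set a b S' -> S = S'.

Notation grid m n := ('I_m.+1 *p 'I_n.+1)%type.

(* A chain of length [m + n] has [m + n + 1] elements. *)
Definition full_sublattice m n (S : {set grid m n}) : Prop :=
  [/\ meet_closed S, join_closed S &
      exists C : {set grid m n}, [/\ C \subset S, chain C & #|C| = (m + n).+1]].

Local Open Scope ring_scope.

Definition ideal_generated_by (R : comNzRingType) (G : R -> Prop) (f : R) : Prop :=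
  exists s : seq (R * R),
    (forall u, u \in s -> G u.2) /\ f = \sum_(u <- s) u.1 * u.2.

Definition generating_set (R : comNzRingType) (I G : R -> Prop) : Prop :=
  forall f, ideal_generated_by G f <-> I f.

Definition minimal_generating_set (R : comNzRingType) (I G : R -> Prop) : Prop :=
  generating_set I G /\
  forall H : R -> Prop,
    (forall f, H f -> G f) -> generating_set I H -> forall f, G f -> H f.

Definition binomial_poly (K : fieldType) n (f : {mpoly K[n]}) : Prop :=
  exists m1 m2 : 'X_{1..n}, f = 'X_[m1] - 'X_[m2].

Section Hibi.
Context (K : fieldType) {disp : Order.disp_t} (L : finLatticeType disp).

Definition hibi_var (a : L) : {mpoly K[#|L|]} := 'X_(enum_rank a).

Definition hibi_binomial (a b : L) : {mpoly K[#|L|]} :=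
  hibi_var a * hibi_var b
  - hibi_var (Order.meet a b) * hibi_var (Order.join a b).

Definition hibi_ideal : {mpoly K[#|L|]} -> Prop :=
  ideal_generated_by (fun f => exists a b, f = hibi_binomial a b).

Definition hibi_relations_indispensable : Prop :=
  forall G : {mpoly K[#|L|]} -> Prop,
    minimal_generating_set hibi_ideal G -> (forall f, G f -> binomial_poly f) ->
  forall a b : L, (a >< b)%O ->
    G (hibi_binomial a b) \/ G (- hibi_binomial a b).

End Hibi.

(* Main.v *)
Require Import Defs.
From HB Require Import structures.
From mathcomp Require Import all_boot all_order all_algebra.
From mathcomp Require Import mpoly.
From Stdlib Require Import Classical.

(* (a) => (b): two complementary sets {c, d} and {c', d'} of [a, b] allow
   z_c z_d - z_a z_b to be replaced by z_c z_d - z_c' z_d' among the Hibi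
   relations, so some minimal binomial generating set avoids it.
   (b) => (c): if p, q, r are maximal in an ideal I, the interval from
   I \ {p, q, r} to I is a Boolean cube, which has several complementary sets.
   (c) => (d): P has width at most 2, and Galvin's proof of Dilworth's theorem
   applies.
   (d) => (e): I is sent to (|I cap C|, |I cap D|).
   (e) => (a): for every modular weight w on L the substitution z_x := X^(w x)
   kills I_L.  Taking for w the indicators of the coordinates of the embedding
   shows that the only monomials with the same weights as z_a z_b are z_a z_b
   and z_(a meet b) z_(a join b).  Some element of a generating set must involve
   a divisor of z_a z_b, and being a nonzero binomial it is the Hibi relation. *)

Set Implicit Arguments.
Unset Strict Implicit.
Unset Printing Implicit Defensive.

Import Order.TTheory GRing.Theory.

Lemma set2_eq_neq (T : finType) (c e x y : T) : x != y -> [set x; y] = [set c; e] ->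
  (x = c /\ y = e) \/ (x = e /\ y = c).
Proof.
move=> xy eqS; move: (set21 x y) (set22 x y) xy; rewrite eqS !inE.
by move=> /orP[]/eqP-> /orP[]/eqP->; rewrite ?eqxx //=; [left | right].
Qed.

(** * Maximal elements, antichains and chain covers of a finite poset *)

Section Poset.
Context {d : Order.disp_t} {P : finPOrderType d}.
Implicit Types (x y z a : P) (S C D I G : {set P}).
Local Open Scope order_scope.

(** Among the elements of [S] above [x], one with the largest principal ideal is maximal, since a
    strictly larger element has a strictly larger principal ideal. *)
Lemma exists_maximal S x : x \in S ->
  exists y, [/\ x <= y, y \in S & {in S, forall z, y <= z -> z = y}].
Proof.
move=> xS; have xP : (x \in S) && (x <= x) by rewrite xS lexx.
pose down_card y := #|[set z | z <= y]|.
case: (@arg_maxnP P x [pred y in S | x <= y] down_card xP) => y /andP[yS xy] ymax.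
exists y; split=> // z zS yz; apply/eqP/contraT => zy.
have ltyz : y < z by rewrite lt_def zy.
have := ymax z; rewrite /= zS (le_trans xy yz) => /(_ isT).
rewrite leqNgt => /negP[].
apply: proper_card; apply/properP; split.
  by apply/subsetP => u; rewrite !inE => uy; apply: le_trans uy yz.
by exists z; rewrite !inE ?lexx // lt_geF.
Qed.

Definition maximal_elements I : {set P} :=
  [set x in I | [forall y in I, (x <= y) ==> (y == x)]].

Lemma maximal_elements_sub I : maximal_elements I \subset I.
Proof. by apply/subsetP => x; rewrite inE => /andP[]. Qed.

Lemma maximal_generators I : poset_ideal I -> generates (maximal_elements I) I.
Proof.
move=> /poset_idealP idI; apply/setP => p; rewrite inE.
apply/idP/exists_inP => [/exists_maximal[y [py yI ymax]] | [g]].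
  exists y => //; rewrite inE yI; apply/forall_inP => z zI.
  by apply/implyP => /(ymax z zI) ->.
by rewrite inE => /andP[gI _]; apply: idI.
Qed.

(** An element of [I] above a removed maximal one coincides with it and is removed too. *)
Lemma poset_ideal_remove_maximal I S :
  poset_ideal I -> S \subset maximal_elements I -> poset_ideal (I :\: S).
Proof.
move=> /poset_idealP idI /subsetP Smax; apply/poset_idealP => x y.
case/setDP=> xI xS yx; rewrite !inE (idI x y xI yx) andbT.
apply: contra xS => yS; have := Smax y yS; rewrite inE => /andP[_ /forall_inP].
by move=> /(_ x xI)/implyP/(_ yx)/eqP->.
Qed.

(** Any generating set of the ideal below a three-element antichain contains all three elements. *)
Lemma two_generated_antichain :
  (forall I, poset_ideal I -> exists G, (#|G| <= 2)%N /\ generates G I) ->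
  forall x y z, ~~ [&& x >< y, y >< z & x >< z].
Proof.
move=> gen x y z; apply/negP => /and3P[xy yz xz].
pose A := [set x; y; z].
have antiA : {in A &, forall u v, u <= v -> u = v}.
  move=> u v; rewrite !inE => /orP[/orP[]|] /eqP-> /orP[/orP[]|] /eqP-> //;
  by move=> le_uv; move: xy yz xz; rewrite /Order.comparable le_uv ?orbT.
pose I := [set p | [exists a in A, p <= a]].
have idI : poset_ideal I.
  apply/poset_idealP => u v; rewrite !inE => /exists_inP[a aA ua] vu.
  by apply/exists_inP; exists a => //; apply: le_trans ua.
have [G [G2 genG]] := gen I idI.
have AG : A \subset G.
  apply/subsetP => a aA; have : a \in I.
    by rewrite inE; apply/exists_inP; exists a.
  rewrite {1}genG inE => /exists_inP[g gG ag].
  have : g \in I by rewrite genG inE; apply/exists_inP; exists g.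
  rewrite inE => /exists_inP[b bA gb].
  have ab := antiA _ _ aA bA (le_trans ag gb).
  by suff -> : a = g by []; apply/le_anti; rewrite ag ab.
have := leq_trans (subset_leq_card AG) G2.
have neq (u v : P) : u >< v -> u != v.
  by apply: contraNneq => ->; apply: comparablexx.
rewrite /A setUC cardsU1 cards2 !inE (neq x y xy).
by rewrite [z == x]eq_sym [z == y]eq_sym (negPf (neq x z xz)) (negPf (neq y z yz)).
Qed.

(* Galvin's step: beyond [x1] nothing in [C] is incomparable to [D], so moving
   the part of [C] below [x1] to the chain of [a] leaves a chain. *)
Lemma two_chain_cover_step C D a x1 :
  chain C -> chain D -> x1 \in C -> x1 <= a ->
  {in C, forall z, x1 < z -> {in D, forall y, z >=< y}} ->
  exists C' D', [/\ chain C', chain D' & C' :|: D' = a |: (C :|: D)].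
Proof.
move=> chC chD x1C x1a above.
exists (a |: [set z in C | z <= x1]), ([set z in C | x1 < z] :|: D); split.
- move=> u v; rewrite !inE.
  case/orP=> [/eqP-> | /andP[uC ux1]] /orP[/eqP-> | /andP[vC vx1]].
  + exact: comparablexx.
  + by apply: ge_comparable; apply: le_trans x1a.
  + by apply: le_comparable; apply: le_trans x1a.
  + exact: chC.
- move=> u v; rewrite !inE.
  case/orP=> [/andP[uC ux1] | uD] /orP[/andP[vC vx1] | vD].
  + exact: chC.
  + exact: above.
  + by rewrite comparable_sym; apply: above.
  + exact: chD.
apply/setP => u; rewrite !inE -!orbA; congr (_ || _); rewrite orbA; congr (_ || _).
have [uC /=|//] := boolP (u \in C).
by have := chC _ _ uC x1C; case: (comparableP u x1).
Qed.

(** Induction on the size: a maximal [a] is removed and the rest covered by [C] and [D]. The highest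
    elements [x1] of [C] and [x2] of [D] that are incomparable to something in the other chain form
    an antichain, so [a] is above one of them, where [two_chain_cover_step] applies. *)
Lemma width2_chain_cover S :
  {in S & &, forall x y z, ~~ [&& x >< y, y >< z & x >< z]} ->
  exists C D, [/\ chain C, chain D & C :|: D = S].
Proof.
have [n] := ubnP #|S|; elim: n => // n IHn in S * => cardS width.
have [->|[s sS]] := set_0Vmem S.
  by exists set0, set0; split; rewrite ?setU0 // => x y; rewrite inE.
have [a [_ aS amax]] := exists_maximal sS.
have S'S : S :\ a \subset S by apply: subD1set.
have [||C [D [chC chD CDE]]] := IHn (S :\ a).
- by move: cardS; rewrite (cardsD1 a S) aS.
- move=> x y z /(subsetP S'S) xS /(subsetP S'S) yS /(subsetP S'S) zS.
  exact: width.
have defS : S = a |: (C :|: D) by rewrite CDE setD1K.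
have CS : C \subset S by rewrite defS -setUCA subsetUl.
have DS : D \subset S by rewrite defS setUA subsetUr.
pose C0 := [set x in C | [exists y in D, x >< y]].
have [C0_0 | [x xC0]] := set_0Vmem C0.
  (* Without incomparable pairs across the two chains, their union is a chain and [a] alone forms
     the other. *)
  exists [set a], (C :|: D); split=> //.
    by move=> u v /set1P-> /set1P->; apply: comparablexx.
  have CD : {in C & D, forall u v, u >=< v}.
    move=> u v uC vD; apply/contraT => uv.
    suff : u \in C0 by rewrite C0_0 inE.
    by rewrite inE uC; apply/exists_inP; exists v.
  move=> u v /setUP[uC|uD] /setUP[vC|vD]; [exact: chC | exact: CD | | exact: chD].
  by rewrite comparable_sym; apply: CD.
pose D0 := [set y in D | [exists x in C, x >< y]].
have [y yD0] : exists y, y \in D0.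
  move: xC0; rewrite inE => /andP[xC /exists_inP[y yD xy]].
  by exists y; rewrite inE yD; apply/exists_inP; exists x.
have [x1 [_ x1C0 x1max]] := exists_maximal xC0.
have [x2 [_ x2D0 x2max]] := exists_maximal yD0.
move: (x1C0) (x2D0); rewrite !inE => /andP[x1C /exists_inP[v vD x1v]].
move=> /andP[x2D /exists_inP[u uC ux2]].
have aboveC : {in C, forall z, x1 < z -> {in D, forall t, z >=< t}}.
  move=> z zC x1z t tD; apply/contraT => zt.
  have zC0 : z \in C0 by rewrite inE zC; apply/exists_inP; exists t.
  by move: (x1z); rewrite (x1max z zC0 (ltW x1z)) ltxx.
have aboveD : {in D, forall z, x2 < z -> {in C, forall t, z >=< t}}.
  move=> z zD x2z t tC; apply/contraT; rewrite comparable_sym => zt.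
  have zD0 : z \in D0 by rewrite inE zD; apply/exists_inP; exists t.
  by move: (x2z); rewrite (x2max z zD0 (ltW x2z)) ltxx.
(* If [x1 <= x2], the partner [u] of [x2] in [C] is either below [x1], hence below [x2], or above
   [x1], against the choice of [x1]. The other case is symmetric. *)
have x12 : x1 >< x2.
  apply/negP => /orP[le12 | le21].
  - have [ux1 | ltx1u] := boolP (u <= x1).
      by move/negP: ux2; apply; apply/le_comparable/(le_trans ux1).
    have := chC _ _ x1C uC; rewrite comparable_sym.
    case: (comparableP u x1) ltx1u => // ltx1u _ _.
    by move/negP: ux2; apply; apply: aboveC.
  - have [vx2 | ltx2v] := boolP (v <= x2).
      by move/negP: x1v; apply; apply/ge_comparable/(le_trans vx2).
    have := chD _ _ x2D vD; rewrite comparable_sym.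
    case: (comparableP v x2) ltx2v => // ltx2v _ _.
    by move/negP: x1v; apply; rewrite comparable_sym; apply: aboveD.
have max_le z : z \in S -> a >=< z -> z <= a.
  by move=> zS /orP[az|//]; rewrite (amax z zS az).
have x1S := subsetP CS _ x1C; have x2S := subsetP DS _ x2D.
have [ax1 | ax1] := boolP (a >=< x1).
  rewrite defS; apply: (two_chain_cover_step chC chD x1C) aboveC.
  exact: max_le.
have [ax2 | ax2] := boolP (a >=< x2).
  rewrite defS (setUC C); apply: (two_chain_cover_step chD chC x2D) aboveD.
  exact: max_le.
by have := width a x1 x2 aS x1S x2S; rewrite ax1 x12 ax2.
Qed.

Lemma disjoint_chain_cover_of_antichain :
  (forall x y z, ~~ [&& x >< y, y >< z & x >< z]) ->
  exists C D, disjoint_chain_cover C D.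
Proof.
move=> width; have [|C [D [chC chD CD]]] := @width2_chain_cover setT.
  by move=> x y z *; apply: width.
exists C, (D :\: C); split=> //.
- by move=> x y /setDP[xD _] /setDP[yD _]; apply: chD.
- by rewrite -CD; apply/setP => u; rewrite !inE; case: (u \in C).
- by apply/setP => u; rewrite !inE; case: (u \in C).
Qed.

End Poset.

(** * The ideal lattice: removal of maximal elements and traces on chains *)

Section IdealLattice.
Context {d : Order.disp_t} {P : finPOrderType d}.
Implicit Types (x y z a : P) (S C D G : {set P}) (I J : ideal_lattice P).
Local Open Scope order_scope.

Lemma ideal_setP I : poset_ideal (ideal_set I).
Proof. exact: valP I. Qed.

Lemma ideal_set_inj : injective (@ideal_set d P).
Proof. exact: val_inj. Qed.

Lemma ideal_leE I J : (I <= J) = (ideal_set I \subset ideal_set J).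
Proof. by rewrite leEsub Order.SetSubsetOrder.leEsubset. Qed.

Lemma ideal_meetE I J : ideal_set (I `&` J) = ideal_set I :&: ideal_set J.
Proof. by []. Qed.

Lemma ideal_joinE I J : ideal_set (I `|` J) = ideal_set I :|: ideal_set J.
Proof. by []. Qed.

(** The default [I] is the value when the difference is not an ideal; for sets of maximal elements
    the difference is one. *)
Definition remove I S : ideal_lattice P := insubd I (ideal_set I :\: S).

Lemma ideal_set_remove I S : S \subset maximal_elements (ideal_set I) ->
  ideal_set (remove I S) = ideal_set I :\: S.
Proof.
move=> Smax; rewrite [LHS]val_insubd.
by rewrite (poset_ideal_remove_maximal (ideal_setP I) Smax).
Qed.

Lemma remove_inj I S S' :
  S \subset maximal_elements (ideal_set I) ->
  S' \subset maximal_elements (ideal_set I) ->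
  remove I S = remove I S' -> S = S'.
Proof.
move=> Smax S'max /(congr1 (@ideal_set d P)).
rewrite !ideal_set_remove // => /(congr1 (setD (ideal_set I))).
have sub (T : {set P}) :
    T \subset maximal_elements (ideal_set I) -> T \subset ideal_set I.
  by move=> Tmax; apply: subset_trans Tmax _; apply: maximal_elements_sub.
by rewrite !setDDr !setDv !set0U (setIidPr (sub _ Smax)) (setIidPr (sub _ S'max)).
Qed.

(** Complementation in [I] turns the union of [S] and [S'] into the meet, and their empty
    intersection into the join [I]. *)
Lemma complementary_remove I S S' :
  S \subset maximal_elements (ideal_set I) ->
  S' \subset maximal_elements (ideal_set I) ->
  S :&: S' = set0 -> S != set0 -> S' != set0 ->
  complementary_set (remove I (S :|: S')) I [set remove I S; remove I S'].
Proof.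
move=> Smax S'max SS'0 S0 S'0.
have Umax : S :|: S' \subset maximal_elements (ideal_set I) by rewrite subUset Smax.
exists (remove I S), (remove I S'); split=> //.
- by rewrite !ideal_leE !ideal_set_remove // subsetDl setDS ?subsetUl.
- by rewrite !ideal_leE !ideal_set_remove // subsetDl setDS ?subsetUr.
- split; apply: ideal_set_inj.
    by rewrite ideal_joinE !ideal_set_remove // -setDIr SS'0 setD0.
  by rewrite ideal_meetE !ideal_set_remove // -setDUr.
(* Equal sets would give [S :|: S' = S] or [S :|: S' = S'], impossible for disjoint nonempty
   sets. *)
apply/negP => /eqP/setP/(_ (remove I (S :|: S'))); rewrite !inE eqxx /=.
case/orP=> /eqP/remove_inj => /(_ Umax) eqU.
  by case/eqP: S'0; rewrite -SS'0 -{1}(eqU Smax) setIC setKU.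
by case/eqP: S0; rewrite -SS'0 -{1}(eqU S'max) setIC setUK.
Qed.

Lemma conditionally_URC_two_generated : conditionally_URC (ideal_lattice P) ->
  forall I : {set P}, poset_ideal I -> exists G, (#|G| <= 2)%N /\ generates G I.
Proof.
move=> urc I0 idI; exists (maximal_elements I0).
split; last exact: maximal_generators.
rewrite leqNgt; apply/negP => /card_gt2P[p [q [r [[pM qM rM] [pq qr rp]]]]].
pose I := IdealLattice idI : ideal_lattice P.
have sub1 x : x \in maximal_elements I0 -> [set x] \subset maximal_elements I0.
  by rewrite sub1set.
have sub2 x y : x \in maximal_elements I0 -> y \in maximal_elements I0 ->
    [set x; y] \subset maximal_elements I0.
  by rewrite subUset => /sub1-> /sub1->.
have disj x y z : x != y -> x != z -> [set x] :&: [set y; z] = set0.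
  move=> xy xz; apply/setP => u; rewrite !inE.
  by case: eqP => //= ->; rewrite (negPf xy) (negPf xz).
have nonempty (x : P) S : x \in S -> S != set0 by move=> xS; apply/set0Pn; exists x.
(* Splitting the three maximal elements as [p | q, r] and as [q | p, r] gives two complementary sets
   of one interval. *)
have compl1 := @complementary_remove I [set p] [set q; r]
  (sub1 p pM) (sub2 q r qM rM).
have compl2 := @complementary_remove I [set q] [set p; r]
  (sub1 q qM) (sub2 p r pM rM).
rewrite setUCA in compl2.
have le_top : remove I ([set p] :|: [set q; r]) <= I.
  by rewrite ideal_leE ideal_set_remove ?subsetDl // subUset sub1 // sub2.
have /setP/(_ (remove I [set p])) : [set remove I [set p]; remove I [set q; r]]
    = [set remove I [set q]; remove I [set p; r]].
  apply: (urc _ _ le_top); [apply: compl1 | apply: compl2].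
  - by apply: disj; rewrite // eq_sym.
  - by apply: (nonempty p); rewrite inE.
  - by apply: (nonempty q); rewrite !inE eqxx.
  - by apply: disj; rewrite // eq_sym.
  - by apply: (nonempty q); rewrite inE.
  - by apply: (nonempty p); rewrite !inE eqxx.
(* Equality of the two sets would force [{p} = {q}] or [{p} = {p, r}]. *)
rewrite !inE eqxx; case/esym/orP => /eqP/remove_inj eqS.
  by have /setP/(_ p) := eqS (sub1 p pM) (sub1 q qM); rewrite !inE eqxx (negPf pq).
have /setP/(_ r) := eqS (sub1 p pM) (sub2 p r pM rM).
by rewrite !inE eqxx orbT (negPf rp).
Qed.

(** Given a point of [C] in [I] only and one in [J] only, the smaller of the two would lie in both
    ideals. *)
Lemma ideal_traces_nested C I J : chain C ->
  (ideal_set I :&: C \subset ideal_set J :&: C)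
    || (ideal_set J :&: C \subset ideal_set I :&: C).
Proof.
move=> chC; apply/contraT; rewrite negb_or.
case/andP=> /subsetPn[x /setIP[xI xC]] + /subsetPn[y /setIP[yJ yC]].
rewrite !inE xC yC !andbT => xJ yI.
case/orP: (chC x y xC yC) => [xy | yx].
  by case/negP: xJ; move/poset_idealP: (ideal_setP J) => /(_ _ _ yJ xy).
by case/negP: yI; move/poset_idealP: (ideal_setP I) => /(_ _ _ xI yx).
Qed.

(** On a chain the trace of an ideal is an initial segment, hence determined by its size, which
    serves as a grid coordinate. *)
Definition trace_card C I : 'I_#|C|.+1 := inord #|ideal_set I :&: C|.

Lemma trace_cardE C I : trace_card C I = #|ideal_set I :&: C| :> nat.
Proof. by rewrite inordK // ltnS subset_leq_card // subsetIr. Qed.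

Lemma trace_card_le C I J :
  ideal_set I :&: C \subset ideal_set J :&: C -> trace_card C I <= trace_card C J.
Proof. by move=> IJ; rewrite leEord !trace_cardE subset_leq_card. Qed.

Lemma trace_card_meet C : chain C ->
  {morph trace_card C : I J / I `&` J >-> I `&` J}.
Proof.
move=> chC I J; rewrite {1}/trace_card ideal_meetE setIIl.
case/orP: (ideal_traces_nested I J chC) => sIJ.
  by rewrite (setIidPl sIJ) meet_l // trace_card_le.
by rewrite (setIidPr sIJ) meet_r // trace_card_le.
Qed.

Lemma trace_card_join C : chain C ->
  {morph trace_card C : I J / I `|` J >-> I `|` J}.
Proof.
move=> chC I J; rewrite {1}/trace_card ideal_joinE setIUl.
case/orP: (ideal_traces_nested I J chC) => sIJ.
  by rewrite (setUidPr sIJ) join_r // trace_card_le.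
by rewrite (setUidPl sIJ) join_l // trace_card_le.
Qed.

Lemma trace_card_eq C I J : chain C -> trace_card C I = trace_card C J ->
  ideal_set I :&: C = ideal_set J :&: C.
Proof.
move=> chC /(congr1 val); rewrite /= !trace_cardE => eqIJ; apply/eqP.
case/orP: (ideal_traces_nested I J chC) => sIJ; first by rewrite eqEcard sIJ eqIJ /=.
by rewrite eq_sym eqEcard sIJ eqIJ /=.
Qed.

(** Maximal elements are deleted one at a time until the empty ideal is reached. For the top ideal
    this chain yields fullness of the embedding. *)
Lemma exists_full_chain_below I : exists F : {set ideal_lattice P},
  [/\ chain F, #|F| = #|ideal_set I|.+1 & {in F, forall J, J <= I}].
Proof.
have [n] := ubnP #|ideal_set I|; elim: n => // n IHn in I * => cardI.
have [I0 | [x /exists_maximal[m [_ mI mmax]]]] := set_0Vmem (ideal_set I).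
  exists [set I]; split; first by move=> ? ? /set1P-> /set1P->; apply: comparablexx.
    by rewrite I0 cards1 cards0.
  by move=> J /set1P->.
have idI' : poset_ideal (ideal_set I :\: [set m]).
  apply: poset_ideal_remove_maximal; first exact: ideal_setP.
  rewrite sub1set inE mI; apply/forall_inP => y yI.
  by apply/implyP => /(mmax y yI)->.
pose I' : ideal_lattice P := IdealLattice idI'.
have cardI' : #|ideal_set I| = #|ideal_set I'|.+1 by rewrite (cardsD1 m) mI.
have leI'I : I' <= I by rewrite ideal_leE subsetDl.
have [|F [chF cardF leF]] := IHn I'; first by rewrite -ltnS -cardI'.
have leFI J : J \in F -> J <= I by move/leF/le_trans; apply.
exists (I |: F); split.
- move=> J J' /setU1P[->|JF] /setU1P[->|J'F]; first exact: comparablexx.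
  + exact/ge_comparable/leFI.
  + exact/le_comparable/leFI.
  + exact: chF.
- rewrite cardsU1 cardF cardI' (_ : I \notin F) //.
  apply/negP => /leF; rewrite ideal_leE => /subset_leq_card.
  by rewrite cardI' ltnn.
- by move=> J /setU1P[->|/leFI].
Qed.

(** Injectivity holds because an ideal is the union of its traces on [C] and [D]. *)
Lemma chain_cover_grid_embedding C D : disjoint_chain_cover C D ->
  exists f : {lmorphism ideal_lattice P -> grid #|C| #|D|},
    injective f /\ full_sublattice [set f I | I : ideal_lattice P].
Proof.
case=> chC chD CD CD0; pose f I : grid #|C| #|D| := (trace_card C I, trace_card D I).
have fle : {homo f : I J / I <= J}.
  by move=> I J; rewrite ideal_leE leEprod => IJ; rewrite !trace_card_le ?setSI.
have fI : {morph f : I J / I `&` J >-> I `&` J}.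
  by move=> I J; rewrite meetEprod /f !trace_card_meet.
have fU : {morph f : I J / I `|` J >-> I `|` J}.
  by move=> I J; rewrite joinEprod /f !trace_card_join.
have finj : injective f.
  move=> I J [eqC eqD]; apply: ideal_set_inj.
  rewrite -[LHS]setIT -[RHS]setIT -CD !setIUr.
  by rewrite (trace_card_eq chC eqC) (trace_card_eq chD eqD).
pose g : {lmorphism ideal_lattice P -> grid #|C| #|D|} :=
  HB.pack f (Order.isOrderMorphism.Build _ _ _ _ f fle)
    (Order.isMeetLatticeMorphism.Build _ _ _ _ f fI)
    (Order.isJoinLatticeMorphism.Build _ _ _ _ f fU).
exists g; split=> //; split.
- by move=> _ _ /imsetP[I _ ->] /imsetP[J _ ->]; rewrite -omorphI imset_f.
- by move=> _ _ /imsetP[I _ ->] /imsetP[J _ ->]; rewrite -omorphU imset_f.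
have [F [chF cardF _]] := exists_full_chain_below \top.
exists [set g I | I in F]; split; first by apply/imsetS/subsetP.
  move=> _ _ /imsetP[I IF ->] /imsetP[J JF ->].
  by case/orP: (chF I J IF JF) => /(omorph_le g) IJ;
    rewrite /Order.comparable IJ ?orbT.
(* The chain has [#|P| + 1] elements, and [#|C| + #|D| = #|P|] by disjointness. *)
by rewrite card_imset // cardF -cardsUI CD CD0 cards0 addn0.
Qed.
End IdealLattice.

(** * Generated ideals and minimal generating subsets of finite lists *)

Section IdealGeneratedBy.
Context {R : comNzRingType}.
Implicit Types (G H I : R -> Prop) (f g : R).
Local Open Scope ring_scope.

Lemma mem_ideal_generated_by G g : G g -> ideal_generated_by G g.
Proof.
move=> Gg; exists [:: (1, g)]; split; first by move=> u; rewrite inE => /eqP->.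
by rewrite big_seq1 mul1r.
Qed.

Lemma ideal_generated_by0 G : ideal_generated_by G 0.
Proof. by exists [::]; rewrite big_nil. Qed.

Lemma ideal_generated_byD G f g :
  ideal_generated_by G f -> ideal_generated_by G g -> ideal_generated_by G (f + g).
Proof.
move=> [s [sG ->]] [t [tG ->]]; exists (s ++ t); split; last by rewrite big_cat.
by move=> u; rewrite mem_cat => /orP[/sG|/tG].
Qed.

Lemma ideal_generated_byM G r f :
  ideal_generated_by G f -> ideal_generated_by G (r * f).
Proof.
move=> [s [sG ->]]; exists [seq (r * u.1, u.2) | u <- s]; split.
  by move=> _ /mapP[u us ->]; exact: (sG u).
by rewrite big_map mulr_sumr; apply: eq_bigr => u _; rewrite mulrA.
Qed.

Lemma ideal_generated_byN G f : ideal_generated_by G f -> ideal_generated_by G (- f).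
Proof. by rewrite -mulN1r; apply: ideal_generated_byM. Qed.

Lemma ideal_generated_by_trans G H f :
  (forall g, G g -> ideal_generated_by H g) ->
  ideal_generated_by G f -> ideal_generated_by H f.
Proof.
move=> GH [s [sG ->]]; elim: s sG => [|u s IHs] sG.
  by rewrite big_nil; apply: ideal_generated_by0.
rewrite big_cons; apply: ideal_generated_byD.
  by apply/ideal_generated_byM/GH/sG; rewrite mem_head.
by apply: IHs => v vs; apply: sG; rewrite inE vs orbT.
Qed.

(** Generators are discarded while the rest still generates. When none can be, no proper subset
    generates, since a subset missing [f] lies in the list without [f]. *)
Lemma finite_minimal_generating_subset I (s : seq R) :
  generating_set I (fun f => f \in s) ->
  exists2 t : seq R, {subset t <= s} & minimal_generating_set I (fun f => f \in t).
Proof.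
have [n] := ubnP (size s); elim: n => // n IHn in s * => size_s gen_s.
have [[f fs gen_f]|min_s] := classic
  (exists2 f, f \in s & generating_set I (fun g => g \in [seq g <- s | g != f])).
  have [|t ts min_t] := IHn _ _ gen_f; last first.
    by exists t => // g /ts; rewrite mem_filter => /andP[].
  rewrite ltnS in size_s; apply: leq_trans size_s.
  rewrite size_filter -[X in (_ < X)%N](count_predC (pred1 f)).
  rewrite -[X in (X < _)%N]add0n ltn_add2r -has_count.
  by apply/hasP; exists f => //=.
exists s => //; split=> // H Hs gen_H f fs; apply: NNPP => nHf.
apply: min_s; exists f => // g; split=> [|Ig].
  move=> Fg; apply/gen_s; apply: ideal_generated_by_trans Fg => h.
  by rewrite mem_filter => /andP[_ hs]; apply: mem_ideal_generated_by.
apply: ideal_generated_by_trans ((gen_H g).2 Ig) => h Hh.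
apply: mem_ideal_generated_by; rewrite mem_filter Hs // andbT.
by apply: contra_notN nHf => /eqP<-.
Qed.

End IdealGeneratedBy.

(** * Monomials and differences of two monomials *)

Section Multinomials.
Context {K : fieldType} {n : nat}.
Local Open Scope ring_scope.

Lemma mpolyX_sub_support (m m1 m2 : 'X_{1..n}) :
  ('X_[m1] - 'X_[m2] : {mpoly K[n]})@_m != 0 -> (m == m1) || (m == m2).
Proof.
rewrite mcoeffB !mcoeffX [m == m1]eq_sym [m == m2]eq_sym.
by case: (m1 == m); case: (m2 == m); rewrite ?subrr ?eqxx.
Qed.

Lemma mpolyX_sub_neq0 (m1 m2 : 'X_{1..n}) : m1 != m2 ->
  ('X_[m1] - 'X_[m2] : {mpoly K[n]})@_m1 != 0
  /\ ('X_[m1] - 'X_[m2] : {mpoly K[n]})@_m2 != 0.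
Proof.
move=> m12; rewrite !mcoeffB !mcoeffX !eqxx [m2 == m1]eq_sym (negPf m12).
by rewrite subr0 sub0r oppr_eq0 oner_eq0.
Qed.

Lemma mcoeffMX_neq0 (p : {mpoly K[n]}) m k : (p * 'X_[m])@_k != 0 -> (m <= k)%MM.
Proof.
rewrite -mcoeff_msupp (perm_mem (msuppMX _ _)) => /mapP[m' _ ->].
by apply/mnm_lepP => i; rewrite mnmDE leq_addr.
Qed.

Lemma mdeg2_sum (m : 'X_{1..n}) : mdeg m = 2 -> exists i j, m = (U_(i) + U_(j))%MM.
Proof.
move=> deg_m; have [i mi] : exists i, m i != 0.
  apply/existsP; rewrite -negb_forall; apply/negP => /forallP m0.
  by move: deg_m; rewrite mdegE big1 // => i _; apply/eqP.
have Um : (U_(i) <= m)%MM by rewrite lep1mP.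
have /mdeg1P[j /eqP mj] : mdeg (m - U_(i)) == 1.
  by have := mdegD (m - U_(i)) U_(i); rewrite submK // deg_m mdeg1 addn1 => -[<-].
by exists j, i; rewrite -mj submK.
Qed.
End Multinomials.

(** * Modular weights and the substitutions that kill the Hibi ideal *)

Section ToricWeights.
Context {K : fieldType} {disp : Order.disp_t} (L : finLatticeType disp).
Implicit Types (a b c x y : L) (w : L -> nat) (m : 'X_{1..#|L|}).
Local Open Scope ring_scope.

Definition pair_mnm a b : 'X_{1..#|L|} := (U_(enum_rank a) + U_(enum_rank b))%MM.

Lemma pair_mnmE a b x :
  pair_mnm a b (enum_rank x) = ((a == x) + (b == x))%N.
Proof. by rewrite mnmDE !mnm1E !(inj_eq enum_rank_inj). Qed.

Lemma pair_mnmC a b : pair_mnm a b = pair_mnm b a.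
Proof. exact: addmC. Qed.

Lemma pair_mnm_set a b x y : pair_mnm a b = pair_mnm x y -> [set a; b] = [set x; y].
Proof.
move=> eqm; apply/setP => z; move/mnmP/(_ (enum_rank z)): eqm.
by rewrite !pair_mnmE !inE ![z == _]eq_sym; do 4!case: eqP => _.
Qed.

Lemma hibi_binomialE a b : hibi_binomial K a b =
  'X_[pair_mnm a b] - 'X_[pair_mnm (Order.meet a b) (Order.join a b)].
Proof. by rewrite !mpolyXD. Qed.

(** The meet occurs on the right, and it equals [a] or [b] only if these are comparable. *)
Lemma hibi_exponents_neq a b : (a >< b)%O ->
  pair_mnm a b != pair_mnm (Order.meet a b) (Order.join a b).
Proof.
move=> ab; apply/eqP => /pair_mnm_set/setP/(_ (Order.meet a b)).
rewrite !inE eqxx /= eq_meetl eq_meetr => le_ab.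
by move: ab; rewrite /Order.comparable le_ab.
Qed.

Lemma hibi_binomial_comparable a b : (a >=< b)%O -> hibi_binomial K a b = 0.
Proof.
rewrite hibi_binomialE => /orP[le_ab|le_ba].
  by rewrite meet_l // join_r // subrr.
by rewrite meet_r // join_l // pair_mnmC subrr.
Qed.

Definition modular w : Prop :=
  forall a b, (w a + w b = w (Order.meet a b) + w (Order.join a b))%N.

(** The degree of a monomial in the grading where [z_x] has degree [w x]. *)
Definition weight w m : nat := (\sum_i w (enum_val i) * m i)%N.

Lemma weightD w m1 m2 : weight w (m1 + m2) = (weight w m1 + weight w m2)%N.
Proof.
by rewrite /weight -big_split; apply: eq_bigr => i _; rewrite mnmDE mulnDr.
Qed.

Lemma weight_pair w a b : weight w (pair_mnm a b) = (w a + w b)%N.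
Proof.
have wU x : weight w U_(enum_rank x)%MM = w x.
  rewrite /weight (bigD1 (enum_rank x)) //= big1 => [|i ix].
    by rewrite enum_rankK mnm1E eqxx muln1 addn0.
  by rewrite mnm1E eq_sym (negPf ix) muln0.
by rewrite weightD !wU.
Qed.

(** Under [z_x := 'X^(w x)] a monomial becomes the power of ['X] with its weight as exponent, and
    Hibi relations vanish by modularity. *)
Lemma weight_hibi_ideal w m1 m2 : modular w ->
  hibi_ideal ('X_[m1] - 'X_[m2] : {mpoly K[#|L|]}) -> weight w m1 = weight w m2.
Proof.
move=> mod_w; pose phi : {rmorphism {mpoly K[#|L|]} -> {poly K}} :=
  mmap (@polyC K) (fun i => 'X^(w (enum_val i))).
have phiX m : phi 'X_[m] = 'X^(weight w m).
  rewrite [LHS]mmapX /mmap1 /weight expr_sum.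
  by apply: eq_bigr => i _; rewrite exprM.
have phi_hibi g : hibi_ideal g -> phi g = 0.
  move=> [s [hs ->]]; rewrite rmorph_sum big_seq big1 // => u /hs[a [b eu]].
  rewrite rmorphM eu hibi_binomialE rmorphB /= !phiX !weight_pair mod_w subrr.
  by rewrite mulr0.
move=> /phi_hibi/eqP; rewrite rmorphB /= !phiX subr_eq0.
by move=> /eqP/(congr1 (fun p : {poly K} => size p)); rewrite !size_polyXn => -[].
Qed.

End ToricWeights.

(** * Two-element multisets described by multiplicities *)

Section PairCounts.
Local Open Scope nat_scope.

(** The counts at [a] and [b] alone decide the matching, also when [a = b]. *)
Lemma pair_counts (T : eqType) (a b c d : T) :
  (forall k, (c == k) + (d == k) = (a == k) + (b == k)) ->
  (c = a /\ d = b) \/ (c = b /\ d = a).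
Proof.
move=> h; have := h a; have := h b; rewrite !eqxx.
have [->|ca] := eqVneq c a.
  by case: (eqVneq d b); [left | case: (a == b); case: (d == a)].
case: (eqVneq d a) => [->|]; last by case: (b == a).
by case: (eqVneq c b) => [->|]; [right | case: (a == b)].
Qed.

(** In a total order, meet and join are the two elements again; this makes coordinate indicators
    modular. *)
Lemma meet_join_count disp (T : orderType disp) (a b k : T) :
  (a == k) + (b == k) = (Order.meet a b == k) + (Order.join a b == k).
Proof. by case: (leP a b); rewrite // addnC. Qed.

End PairCounts.

(** * Indispensability from an embedding in a product of two chains *)

Section Embedding.
Context (K : fieldType) {disp : Order.disp_t} {L : finLatticeType disp}.
Context {disp1 disp2 disp3 : Order.disp_t}.
Context {T1 : orderType disp1} {T2 : orderType disp2}.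
Context (f : {lmorphism L -> T1 *prod[disp3] T2}) (f_inj : injective f).
Implicit Types (a b c x y : L) (w : L -> nat) (m : 'X_{1..#|L|}).

Lemma embedding_le x y : (f x <= f y)%O -> (x <= y)%O.
Proof. by rewrite !leEmeet -omorphI (inj_eq f_inj). Qed.

Lemma modular_fst (k : T1) : modular (fun x => ((f x).1 == k) : nat).
Proof.
by move=> a b; rewrite omorphI omorphU meetEprod joinEprod /= meet_join_count.
Qed.

Lemma modular_snd (k : T2) : modular (fun x => ((f x).2 == k) : nat).
Proof.
by move=> a b; rewrite omorphI omorphU meetEprod joinEprod /= meet_join_count.
Qed.

(** The constant weight forces degree two, say [m = pair_mnm c e]. By the indicator weights, [c] and
    [e] have the coordinates of [a] and [b], matched alike or crossed. *)
Lemma weight_fiber a b m : (a >< b)%O ->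
  (forall w, modular w -> weight w m = w a + w b) ->
  m = pair_mnm a b \/ m = pair_mnm (Order.meet a b) (Order.join a b).
Proof.
move=> ab wm; have deg_m : mdeg m = 2.
  transitivity (weight (fun=> 1) m); last exact: (wm (fun=> 1) (fun _ _ => erefl)).
  by rewrite /weight mdegE; apply: eq_bigr => i _; rewrite mul1n.
have [c [e defm]] : exists c e, m = pair_mnm c e.
  have [i [j ->]] := mdeg2_sum deg_m.
  by exists (enum_val i), (enum_val j); rewrite /pair_mnm !enum_valK.
have /pair_counts h1 k : ((f c).1 == k) + ((f e).1 == k)
    = ((f a).1 == k) + ((f b).1 == k).
  by rewrite -(wm _ (modular_fst k)) defm weight_pair.
have /pair_counts h2 k : ((f c).2 == k) + ((f e).2 == k)
    = ((f a).2 == k) + ((f b).2 == k).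
  by rewrite -(wm _ (modular_snd k)) defm weight_pair.
have f_eq x y : (f x).1 = (f y).1 -> (f x).2 = (f y).2 -> x = y.
  move=> eq1 eq2; apply: f_inj.
  by rewrite (surjective_pairing (f x)) eq1 eq2 -surjective_pairing.
have fI x y : f (Order.meet x y)
    = (Order.meet (f x).1 (f y).1, Order.meet (f x).2 (f y).2).
  by rewrite omorphI meetEprod.
have fU x y : f (Order.join x y)
    = (Order.join (f x).1 (f y).1, Order.join (f x).2 (f y).2).
  by rewrite omorphU joinEprod.
(* Incomparable [x] and [y] have oppositely ordered coordinates, so exchanging the second ones
   yields their meet and join. *)
have swap x y : (x >< y)%O -> (f c).1 = (f x).1 -> (f e).1 = (f y).1 ->
    (f c).2 = (f y).2 -> (f e).2 = (f x).2 ->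
    m = pair_mnm (Order.meet x y) (Order.join x y).
  move=> xy c1 e1 c2 e2; rewrite defm.
  case: (leP (f x).1 (f y).1) => le1; case: (leP (f x).2 (f y).2) => le2.
  - case/negP: xy; apply: le_comparable; apply: embedding_le.
    by rewrite leEprod le1 le2.
  - congr pair_mnm; apply: f_eq; rewrite ?fI ?fU /= ?(c1, c2, e1, e2).
    + by rewrite meet_l.
    + by rewrite meet_r // ltW.
    + by rewrite join_r.
    + by rewrite join_l // ltW.
  - rewrite pair_mnmC; congr pair_mnm; apply: f_eq;
      rewrite ?fI ?fU /= ?(c1, c2, e1, e2).
    + by rewrite meet_r // ltW.
    + by rewrite meet_l.
    + by rewrite join_l // ltW.
    + by rewrite join_r.
  - case/negP: xy; apply: ge_comparable; apply: embedding_le.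
    by rewrite leEprod !ltW.
case: h1 => [[c1 e1]|[c1 e1]]; case: h2 => [[c2 e2]|[c2 e2]].
- by left; rewrite defm; congr pair_mnm; apply: f_eq.
- by right; apply: swap.
- right; rewrite meetC joinC; apply: swap => //.
  by rewrite comparable_sym.
- by left; rewrite defm pair_mnmC; congr pair_mnm; apply: f_eq.
Qed.

Local Open Scope ring_scope.

(** With [u] the cofactor of [m1] in [z_a z_b], [weight_fiber] identifies [u + m2] as the meet-join
    exponent. Then [u] divides two coprime monomials, so [u = 0]. *)
Lemma hibi_fiber_binomial a b m1 m2 : (a >< b)%O -> (m1 <= pair_mnm a b)%MM ->
  m1 != m2 -> hibi_ideal ('X_[m1] - 'X_[m2] : {mpoly K[#|L|]}) ->
  'X_[m1] - 'X_[m2] = hibi_binomial K a b.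
Proof.
move=> ab le_m1 m12 in_ideal; set M := pair_mnm a b in le_m1 *.
pose u := (M - m1)%MM; have um1 : (u + m1)%MM = M := submK le_m1.
have [w mod_w||um2] := @weight_fiber a b (u + m2)%MM ab.
- rewrite -weight_pair -/M -um1 !weightD.
  by rewrite (weight_hibi_ideal mod_w in_ideal).
- by rewrite -/M -um1 => /addmI m21; rewrite m21 eqxx in m12.
have u0 : u = 0%MM.
  apply/mnmP => i; rewrite mnm0E -[i]enum_valK; set x := enum_val i.
  apply/eqP; rewrite -leqn0; apply/contraT; rewrite -ltnNge => u_gt0.
  have : (0 < pair_mnm a b (enum_rank x))%N by rewrite -/M -um1 mnmDE addn_gt0 u_gt0.
  have : (0 < pair_mnm (Order.meet a b) (Order.join a b) (enum_rank x))%N.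
    by rewrite -um2 mnmDE addn_gt0 u_gt0.
  rewrite !pair_mnmE !addn_gt0 !lt0b.
  (* A common variable would equate [a] or [b] with their meet or join. *)
  move=> /orP[]/eqP x1 /orP[]/eqP x2; case/negP: ab.
  - by apply: le_comparable; rewrite leEmeet x1 x2.
  - by apply: ge_comparable; rewrite leEmeet meetC x1 x2.
  - by apply: ge_comparable; rewrite leEjoin joinC x1 x2.
  - by apply: le_comparable; rewrite leEjoin x1 x2.
by rewrite hibi_binomialE -um2 -/M -um1 u0 !add0m.
Qed.

Lemma embedding_indispensable : hibi_relations_indispensable K L.
Proof.
move=> G [gen_G _] binom_G a b ab; pose M := pair_mnm a b.
have hab : hibi_ideal (hibi_binomial K a b).
  by apply: mem_ideal_generated_by; exists a, b.
have [s [sG def_h]] := (gen_G _).2 hab.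
have [hM _] := mpolyX_sub_neq0 (K := K) (hibi_exponents_neq ab).
rewrite -hibi_binomialE -/M def_h raddf_sum /= in hM.
(* [M] occurs in the relation, hence in some summand, and so one of the two monomials of its
   generator divides [M]. *)
have [u us uM] : exists2 u, u \in s & (u.1 * u.2)@_M != 0.
  apply/hasP; apply: contraT => /hasPn s0; case/eqP: hM.
  by rewrite big_seq big1 // => u /s0; rewrite negbK => /eqP.
have Gu := sG u us; have [m1 [m2 def_u]] := binom_G _ Gu.
have Iu : hibi_ideal u.2 by apply/gen_G/mem_ideal_generated_by.
have m12 : m1 != m2.
  by apply: contraNneq uM => eqm; rewrite def_u eqm subrr mulr0 mcoeff0.
(* Which of [m1] and [m2] divides [M] decides the sign. *)
have [le1|nle1] := boolP (m1 <= M)%MM.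
  by left; rewrite -(hibi_fiber_binomial ab le1 m12) -?def_u.
have le2 : (m2 <= M)%MM.
  apply: contraT => nle2; case/eqP: uM; rewrite def_u mulrBr mcoeffB.
  have zero m : ~~ (m <= M)%MM -> (u.1 * 'X_[m])@_M = 0.
    by move=> nle; apply/eqP/(contraNT _ nle)/mcoeffMX_neq0.
  by rewrite !zero // subrr.
right; rewrite -(hibi_fiber_binomial ab le2 (m2 := m1)) 1?eq_sym //.
  by rewrite opprB -def_u.
by rewrite -opprB -def_u; apply: ideal_generated_byN.
Qed.
End Embedding.

(** * From indispensability to unique complementary sets *)

Section IndispensableURC.
Context (K : fieldType) {disp : Order.disp_t} {L : finLatticeType disp}.
Implicit Types (a b c e x y : L).
Local Open Scope ring_scope.

Lemma incomparable_neq x y : (x >< y)%O -> x != y.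
Proof. by apply: contraNneq => ->; apply: comparablexx. Qed.

Lemma pair_mnm_comparable x y a b :
  (a <= b)%O -> pair_mnm x y = pair_mnm a b -> (x >=< y)%O.
Proof.
move=> ab /pair_mnm_set eqS; apply: contraT => xy.
rewrite -(negPf xy); have [[-> ->]|[-> ->]] := set2_eq_neq (incomparable_neq xy) eqS.
  exact: le_comparable.
exact: ge_comparable.
Qed.

(** For pairs with the same meet and join, the head is the difference of their Hibi relations; it
    replaces the relation of [{c, e}], which the filter drops. *)
Definition exchanged_relations c e c' e' : seq {mpoly K[#|L|]} :=
  ('X_[pair_mnm c e] - 'X_[pair_mnm c' e'])
    :: [seq hibi_binomial K u.1 u.2 | u <- enum {: L * L}
         & (u.1 >< u.2)%O && ([set u.1; u.2] != [set c; e])].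

Lemma exchanged_relations_generate c e c' e' :
  Order.meet c e = Order.meet c' e' -> Order.join c e = Order.join c' e' ->
  (c >< e)%O -> (c' >< e')%O -> [set c; e] != [set c'; e'] ->
  generating_set (@hibi_ideal K _ L) (fun f => f \in exchanged_relations c e c' e').
Proof.
move=> eq_meet eq_join ce ce' neq; set s := exchanged_relations c e c' e'.
have hibi_s x y : (x >< y)%O -> [set x; y] != [set c; e] ->
    hibi_binomial K x y \in s.
  move=> xy nxy; rewrite inE; apply/orP; right; apply/mapP; exists (x, y) => //=.
  by rewrite mem_filter mem_enum /= xy nxy.
have def_new : 'X_[pair_mnm c e] - 'X_[pair_mnm c' e']
    = hibi_binomial K c e - hibi_binomial K c' e'.
  by rewrite !hibi_binomialE eq_meet eq_join opprB addrA subrK.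
move=> f; split; apply: ideal_generated_by_trans => g.
  rewrite inE => /orP[/eqP->|/mapP[[x y] _ ->]]; last first.
    by apply: mem_ideal_generated_by; exists x, y.
  rewrite def_new; apply: ideal_generated_byD; last apply: ideal_generated_byN.
    by apply: mem_ideal_generated_by; exists c, e.
  by apply: mem_ideal_generated_by; exists c', e'.
move=> [x [y ->]].
have [xy|xy] := boolP (x >=< y)%O.
  by rewrite hibi_binomial_comparable //; apply: ideal_generated_by0.
have [eq_xy|neq_xy] := eqVneq [set x; y] [set c; e]; last first.
  exact/mem_ideal_generated_by/hibi_s.
have -> : hibi_binomial K x y = hibi_binomial K c e.
  have [[-> ->]//|[-> ->]] := set2_eq_neq (incomparable_neq xy) eq_xy.
  by rewrite !hibi_binomialE pair_mnmC meetC joinC.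
(* The dropped relation is the head plus the relation of [{c', e'}], kept because the two sets
   differ. *)
rewrite -[hibi_binomial K c e](subrK (hibi_binomial K c' e')) -def_new.
apply: ideal_generated_byD; apply: mem_ideal_generated_by.
  by rewrite mem_head.
by apply: hibi_s => //; rewrite eq_sym.
Qed.

(** Comparable elements are their own meet and join, which would make the pair equal to [{a, b}]. *)
Lemma complementary_set_incomparable a b c e :
  Order.join c e = b -> Order.meet c e = a -> [set c; e] != [set a; b] -> (c >< e)%O.
Proof.
move=> <- <-; apply: contraNN => /orP[ce|ec].
  by rewrite meet_l // join_r.
by rewrite meet_r // join_l // setUC.
Qed.

(** A minimal generating set taken from the exchanged relations must contain the relation of
    [{c, e}] up to sign, yet no exchanged relation involves both [z_c z_e] and [z_a z_b]. *)
Lemma indispensable_conditionally_URC :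
  hibi_relations_indispensable K L -> conditionally_URC L.
Proof.
move=> indisp a b ab S S' [c [e [-> _ _ [jce mce] nce]]].
move=> [c' [e' [-> _ _ [jce' mce'] nce']]].
have ce := complementary_set_incomparable jce mce nce.
have ce' := complementary_set_incomparable jce' mce' nce'.
apply/eqP/contraT => neq.
have [t ts min_t] := finite_minimal_generating_subset
  (exchanged_relations_generate (etrans mce (esym mce')) (etrans jce (esym jce'))
     ce ce' neq).
have binom_t g : g \in t -> binomial_poly g.
  move/ts; rewrite inE => /orP[/eqP->|/mapP[[x y] _ ->]].
    by exists (pair_mnm c e), (pair_mnm c' e').
  by rewrite hibi_binomialE; do 2!eexists.
pose M1 := pair_mnm c e; pose M2 := pair_mnm a b.
have [g gt [g1 g2]] : exists2 g, g \in t & g@_M1 != 0 /\ g@_M2 != 0.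
  have [h1 h2] := mpolyX_sub_neq0 (K := K) (hibi_exponents_neq ce).
  rewrite -hibi_binomialE mce jce -/M1 -/M2 in h1 h2.
  have [t_h|t_h] := indisp _ min_t binom_t c e ce.
    by exists (hibi_binomial K c e).
  by exists (- hibi_binomial K c e); rewrite // !mcoeffN !oppr_eq0.
have {gt} := ts g gt; rewrite inE => /orP[/eqP eg|/mapP[[x y]]].
  (* Both monomials of the head come from incomparable pairs, unlike [z_a z_b]. *)
  move: g2; rewrite eg => /mpolyX_sub_support/orP[]/eqP/esym.
    by move/(pair_mnm_comparable ab); rewrite (negPf ce).
  by move/(pair_mnm_comparable ab); rewrite (negPf ce').
rewrite mem_filter => /andP[/= /andP[xy nxy] _] eg.
(* In a kept Hibi relation, [z_c z_e] would be the product of a different pair or of a comparable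
   meet and join. *)
move: g1; rewrite eg hibi_binomialE => /mpolyX_sub_support/orP[]/eqP eqM.
  by case/eqP: nxy; rewrite (pair_mnm_set eqM).
case/negP: ce; apply: pair_mnm_comparable eqM.
by apply: le_trans (leIl _ _) (leUl _ _).
Qed.
End IndispensableURC.

Theorem theorem1p6 (K : fieldType) (d : Order.disp_t) (P : finPOrderType d) :
  [<-> hibi_relations_indispensable K (ideal_lattice P);
       conditionally_URC (ideal_lattice P);
       forall I : {set P}, poset_ideal I ->
         exists G : {set P}, #|G| <= 2 /\ generates G I;
       exists C D : {set P}, disjoint_chain_cover C D;
       exists C D : {set P}, disjoint_chain_cover C D /\
         exists f : {lmorphism ideal_lattice P -> grid #|C| #|D|},
           injective f /\ full_sublattice [set f I | I : ideal_lattice P]].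
Proof.
tfae.
- exact: indispensable_conditionally_URC.
- exact: conditionally_URC_two_generated.
- move=> gen; apply: disjoint_chain_cover_of_antichain.
  exact: two_generated_antichain.
- move=> [C [D cover]]; exists C, D; split=> //.
  exact: chain_cover_grid_embedding.
- move=> [C [D [_ [f [f_inj _]]]]].
  exact: (embedding_indispensable f_inj).
Qed.
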